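(* Let $\mathbb{K}$ be a field of characteristic $0$, let $A^1$ and $A^2$ be standard graded Artinian $\mathbb{K}$-algebras, and let $A=A^1\otimes_{\mathbb{K}}A^2$. Let $n\ge 1$ be such that $A^1_n\ne 0\ne A^2_n$ and $A^1_{n+1}=0=A^2_{n+1}$. Let $\ell=\alpha\otimes 1+1\otimes\beta\in A_1$ be a general linear form, where $\alpha\in A^1_1$ and $\beta\in A^2_1$. Then $\ker(\mu_\ell:A_n\to A_{n+1})$ is nonzero. Moreover, if there is a pair $i,j\ge 0$ with $i+j=n$ such that both kernels $\ker(\mu_\alpha:A^1_i\to A^1_{i+1})$ and $\ker(\mu_\beta:A^2_j\to A^2_{j+1})$ are nonzero, then $\dim_{\mathbb{K}}\ker(\mu_\ell:A_n\to A_{n+1})\ge 2$.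
   Context: A standard graded Artinian $\mathbb{K}$-algebra is a finite-dimensional quotient of a polynomial ring over $\mathbb{K}$ (variables in degree $1$) by a homogeneous ideal. The tensor product carries the total grading $A_m=\bigoplus_{a+b=m}A^1_a\otimes A^2_b$; in particular $A_1=A^1_1\otimes 1\,\oplus\,1\otimes A^2_1$. For a linear form $\ell$, $\mu_\ell$ denotes multiplication by $\ell$. ''General linear form'' means: there is a nonempty Zariski open subset $U\subseteq A^1_1\times A^2_1$ such that the assertions hold for every $(\alpha,\beta)\in U$. *)

(* Defs.v *)
From HB Require Import structures.
From mathcomp Require Import all_boot all_order all_algebra all_field.
From mathcomp Require Import mpoly.

Set Implicit Arguments.
Unset Strict Implicit.
Unset Printing Implicit Defensive.

Import GRing.Theory.
Local Open Scope ring_scope.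

(* A finite-dimensional algebra presented as a quotient of K[X_1, ..., X_r] by
   a homogeneous ideal: the ideal is the kernel of the surjection sga_pres, and
   it is closed under taking homogeneous components. Commutativity follows from
   surjectivity. A falgType is nonzero, so the zero algebra is excluded. *)
Record stdGradedArtinian (K : fieldType) := StdGradedArtinian {
  sga_alg :> falgType K;
  sga_nvar : nat;
  sga_pres : {lrmorphism {mpoly K[sga_nvar]} -> sga_alg};
  sga_surj : forall x, exists p, sga_pres p = x;
  sga_homog : forall p, sga_pres p = 0 ->
    forall d, sga_pres (pihomog mdeg d p) = 0
}.

Definition gr (K : fieldType) (A : stdGradedArtinian K) (d : nat) : {vspace A} :=
  <<[seq sga_pres A 'X_[val m]
       | m : 'X_{1..(sga_nvar A) < d.+1} in [pred m | mdeg (val m) == d]]>>%VS.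

Lemma memv_gr (K : fieldType) (A : stdGradedArtinian K) (d : nat) (x : A) :
  x \in gr A d <-> exists2 p, p \is d.-homog for mdeg & sga_pres A p = x.
Proof.
split=> [|[p hp <-]].
  rewrite /gr; set s := image _ _ => xs.
  have : forall y, y \in s -> exists2 p, p \is d.-homog for mdeg & sga_pres A p = y.
    move=> y /imageP[m hm ->].
    by exists 'X_[val m]; rewrite ?dhomogX.
  elim: s x xs => [|y s IH] x.
    rewrite span_nil memv0 => /eqP-> _; exists 0; first exact: dhomog0.
    exact: raddf0.
  rewrite span_cons => /memv_addP[u /vlineP[k ->] [v /IH hv ->]] hs.
  have [p hp <-] := hs y (mem_head _ _).
  have [z zs|q hq <-] := hv; first by apply: hs; rewrite inE zs orbT.
  exists (k *: p + q); first by apply: rpredD => //; apply: rpredZ.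
  by rewrite linearP.
rewrite [p]mpolyE raddf_sum /= big_seq; apply: memv_suml => m mp.
rewrite linearZ /=; apply/memvZ/memv_span.
have hm := dhomog_mf hp mp.
have hb : (mdeg m < d.+1)%N by rewrite hm.
by apply/imageP; exists (BMultinom hb) => //; rewrite inE /= hm.
Qed.

Lemma gr_mul (K : fieldType) (A : stdGradedArtinian K) (d e : nat) (x y : A) :
  x \in gr A d -> y \in gr A e -> x * y \in gr A (d + e).
Proof.
move=> /memv_gr[p hp <-] /memv_gr[q hq <-]; apply/memv_gr.
by exists (p * q); [exact: dhomogM | exact: rmorphM].
Qed.

(* The tensor product, as matrices of coordinates in the basis b_i (x) c_j,
   where b and c are the library bases of A and B. *)
Definition tensor (K : fieldType) (A B : vectType K) : Type :=
  'M[K]_(\dim {:A}, \dim {:B}).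

HB.instance Definition _ (K : fieldType) (A B : vectType K) :=
  Vector.on (tensor A B).

Definition tens (K : fieldType) (A B : vectType K) (u : A) (v : B) :
    tensor A B :=
  \matrix_(i, j) (coord (vbasis {:A}) i u * coord (vbasis {:B}) j v).

Section TensorVect.
Variables (K : fieldType) (A B : vectType K).
Implicit Types (u : A) (v : B) (x : tensor A B).

Lemma tensDl u u' v : tens (u + u') v = tens u v + tens u' v.
Proof. by apply/matrixP=> i j; rewrite !mxE linearD mulrDl. Qed.

Lemma tensDr u v v' : tens u (v + v') = tens u v + tens u v'.
Proof. by apply/matrixP=> i j; rewrite !mxE linearD mulrDr. Qed.

Lemma tensZl k u v : tens (k *: u) v = k *: tens u v.
Proof. by apply/matrixP=> i j; rewrite !mxE linearZ mulrA. Qed.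

Lemma tensZr k u v : tens u (k *: v) = k *: tens u v.
Proof. by apply/matrixP=> i j; rewrite !mxE linearZ mulrCA. Qed.

Lemma tensE x :
  x = \sum_i \sum_j x i j *: tens (vbasis {:A})`_i (vbasis {:B})`_j.
Proof.
have fA := basis_free (vbasisP {:A}); have fB := basis_free (vbasisP {:B}).
apply/matrixP=> a b; rewrite !summxE (bigD1 a) //= summxE (bigD1 b) //=.
rewrite !mxE !coord_free // !eqxx !mulr1 !big1 ?addr0 // => i ne.
  rewrite summxE big1 // => j _.
  by rewrite !mxE !coord_free // (negPf ne) mul0r mulr0.
by rewrite !mxE !coord_free // (negPf ne) mulr0 mulr0.
Qed.

Lemma tensor_ind (P : tensor A B -> Prop) :
  (forall x y, P x -> P y -> P (x + y)) -> (forall u v, P (tens u v)) ->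
  forall x, P x.
Proof.
move=> PD Pt x; have P0 : P 0.
  by have := Pt 0 0; rewrite -(scale0r 0) tensZl scale0r.
rewrite [x]tensE; apply: (big_ind P) => // i _; apply: (big_ind P) => // j _.
by rewrite -tensZl.
Qed.

(* The linear map through which a bilinear f factors: tensor_lift_tens and
   tensor_lift_uniq are the universal property of the tensor product. *)
Definition tensor_lift (V : vectType K) (f : A -> B -> V) x : V :=
  \sum_i \sum_j x i j *: f (vbasis {:A})`_i (vbasis {:B})`_j.

Lemma tensor_lift_is_linear (V : vectType K) (f : A -> B -> V) :
  linear (tensor_lift f).
Proof.
move=> k x y; rewrite /tensor_lift scaler_sumr -big_split /=.
apply: eq_bigr => i _; rewrite scaler_sumr -big_split /=.
by apply: eq_bigr => j _; rewrite !mxE scalerDl scalerA.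
Qed.

Lemma tensor_lift_tens (V : vectType K) (f : A -> B -> V) :
  (forall v, linear (f^~ v)) -> (forall u, linear (f u)) ->
  forall u v, tensor_lift f (tens u v) = f u v.
Proof.
move=> fl fr u v.
pose gl w : {linear A -> V} :=
  HB.pack (f^~ w) (GRing.isLinear.Build K A V _ (f^~ w) (fl w)).
pose gr w : {linear B -> V} :=
  HB.pack (f w) (GRing.isLinear.Build K B V _ (f w) (fr w)).
transitivity (gl v u) => //.
rewrite [u in RHS](coord_vbasis (memvf u)) linear_sum.
apply: eq_bigr => i _; rewrite linearZ /=.
transitivity (coord (vbasis {:A}) i u *: gr (vbasis {:A})`_i v) => //.
rewrite [v in RHS](coord_vbasis (memvf v)) linear_sum scaler_sumr.
by apply: eq_bigr => j _; rewrite linearZ /= scalerA !mxE.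
Qed.

Lemma tensor_lift_uniq (V : vectType K) (g h : {linear tensor A B -> V}) :
  (forall u v, g (tens u v) = h (tens u v)) -> g =1 h.
Proof.
by move=> gh; apply: tensor_ind => // x y gx gy; rewrite !linearD gx gy.
Qed.

End TensorVect.

Section TensorAlg.
Variables (K : fieldType) (A B : falgType K).
Implicit Types (x y z : tensor A B).

Definition tensor_one : tensor A B := tens 1 1.

(* (b_i (x) c_j) * (b_k (x) c_l) = b_i b_k (x) c_j c_l, extended bilinearly. *)
Definition tensor_mul x y : tensor A B :=
  tensor_lift (fun a b => tensor_lift (fun a' b' => tens (a * a') (b * b')) y) x.

Lemma tensor_mulDl : left_distributive tensor_mul +%R.
Proof.
move=> x y z.
by rewrite /tensor_mul -[x]scale1r tensor_lift_is_linear !scale1r.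
Qed.

Lemma tensor_mulDr : right_distributive tensor_mul +%R.
Proof.
move=> x y z; rewrite /tensor_mul /tensor_lift -big_split /=.
apply: eq_bigr => i _; rewrite -big_split /=; apply: eq_bigr => j _.
rewrite -scalerDr; congr (_ *: _).
have := tensor_lift_is_linear
  (fun a' b' => tens ((vbasis {:A})`_i * a') ((vbasis {:B})`_j * b')) 1 y z.
by rewrite !scale1r.
Qed.

Lemma tensor_mulE (a a' : A) (b b' : B) :
  tensor_mul (tens a b) (tens a' b') = tens (a * a') (b * b').
Proof.
have inner c d :
  tensor_lift (fun u v => tens (c * u) (d * v)) (tens a' b')
    = tens (c * a') (d * b').
  rewrite (@tensor_lift_tens _ _ _ _ (fun u v => tens (c * u) (d * v))) //.
    by move=> v k u u'; rewrite mulrDr -scalerAr tensDl tensZl.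
  by move=> u k v v'; rewrite mulrDr -scalerAr tensDr tensZr.
transitivity (tensor_lift (fun c d => tens (c * a') (d * b')) (tens a b)).
  apply: eq_bigr => i _; apply: eq_bigr => j _; congr (_ *: _); exact: inner.
rewrite tensor_lift_tens //.
  by move=> v k u u'; rewrite mulrDl -scalerAl tensDl tensZl.
by move=> u k v v'; rewrite mulrDl -scalerAl tensDr tensZr.
Qed.

Lemma tensor_mulA : associative tensor_mul.
Proof.
move=> x y z; elim/tensor_ind: x => [x x' hx hx'|a b].
  by rewrite !tensor_mulDl hx hx'.
elim/tensor_ind: y => [y y' hy hy'|a' b'].
  by rewrite !(tensor_mulDl, tensor_mulDr) hy hy'.
elim/tensor_ind: z => [z z' hz hz'|a'' b''].
  by rewrite !tensor_mulDr hz hz'.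
by rewrite !tensor_mulE !mulrA.
Qed.

Lemma tensor_mul1l : left_id tensor_one tensor_mul.
Proof.
elim/tensor_ind=> [x y hx hy|a b]; first by rewrite tensor_mulDr hx hy.
by rewrite tensor_mulE !mul1r.
Qed.

Lemma tensor_mul1r : right_id tensor_one tensor_mul.
Proof.
elim/tensor_ind=> [x y hx hy|a b]; first by rewrite tensor_mulDl hx hy.
by rewrite tensor_mulE !mulr1.
Qed.

Lemma tens_eq0 (a : A) (b : B) : tens a b = 0 -> a = 0 \/ b = 0.
Proof.
have [->|a0] := eqVneq a 0; first by left.
have [->|b0] := eqVneq b 0; first by right.
suff nz (V : vectType K) (u : V) :
    u != 0 -> exists i, coord (vbasis {:V}) i u != 0.
  have [[i hi] [j hj]] := (nz _ _ a0, nz _ _ b0).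
  move=> /matrixP/(_ i j)/eqP; rewrite !mxE mulf_eq0.
  by rewrite (negPf hi) (negPf hj).
move=> u0; apply/existsP; apply: contraNT u0; rewrite negb_exists => /forallP h.
rewrite [u](coord_vbasis (memvf u)) big1 // => i _.
by have := h i; rewrite negbK => /eqP->; rewrite scale0r.
Qed.

Lemma tensor_one_neq0 : tensor_one != 0.
Proof. by apply/eqP => /tens_eq0[] /eqP; rewrite oner_eq0. Qed.

HB.instance Definition _ := GRing.Zmodule_isNzRing.Build (tensor A B)
  tensor_mulA tensor_mul1l tensor_mul1r tensor_mulDl tensor_mulDr
  tensor_one_neq0.

Lemma tensM (a a' : A) (b b' : B) :
  tens a b * tens a' b' = tens (a * a') (b * b').
Proof. exact: tensor_mulE. Qed.

Lemma tensor_scaleAl (k : K) x y : k *: (x * y) = k *: x * y.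
Proof.
elim/tensor_ind: x => [x x' hx hx'|a b].
  by rewrite mulrDl !scalerDr mulrDl hx hx'.
elim/tensor_ind: y => [y y' hy hy'|a' b'].
  by rewrite !mulrDr scalerDr hy hy'.
by rewrite tensM -!tensZl tensM scalerAl.
Qed.

Lemma tensor_scaleAr (k : K) x y : k *: (x * y) = x * (k *: y).
Proof.
elim/tensor_ind: x => [x x' hx hx'|a b].
  by rewrite !mulrDl scalerDr hx hx'.
elim/tensor_ind: y => [y y' hy hy'|a' b'].
  by rewrite mulrDr !scalerDr mulrDr hy hy'.
by rewrite tensM -!tensZl tensM scalerAr.
Qed.

HB.instance Definition _ :=
  GRing.Lmodule_isLalgebra.Build K (tensor A B) tensor_scaleAl.
HB.instance Definition _ :=
  GRing.Lalgebra_isAlgebra.Build K (tensor A B) tensor_scaleAr.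
HB.instance Definition _ := Algebra_isFalgebra.Build K (tensor A B).

End TensorAlg.

Definition tensv (K : fieldType) (A B : vectType K)
    (U : {vspace A}) (V : {vspace B}) : {vspace tensor A B} :=
  <<[seq tens u v | u <- vbasis U, v <- vbasis V]>>%VS.

Lemma memv_tens (K : fieldType) (A B : vectType K)
    (U : {vspace A}) (V : {vspace B}) u v :
  u \in U -> v \in V -> tens u v \in tensv U V.
Proof.
have tens0l w : tens (0 : A) (w : B) = 0.
  by rewrite -(scale0r 0) tensZl scale0r.
have tens0r w : tens (w : A) (0 : B) = 0.
  by rewrite -(scale0r 0) tensZr scale0r.
move=> /coord_vbasis-> /coord_vbasis->.
apply: (big_ind (fun u => tens u _ \in tensv U V)) => [|x y hx hy|i _].
- by rewrite tens0l mem0v.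
- by rewrite tensDl memvD.
rewrite tensZl memvZ //.
apply: (big_ind (fun v => tens _ v \in tensv U V)) => [|x y hx hy|j _].
- by rewrite tens0r mem0v.
- by rewrite tensDr memvD.
rewrite tensZr memvZ // memv_span //.
by apply/allpairsP; exists ((vbasis U)`_i, (vbasis V)`_j); rewrite !memt_nth.
Qed.

Definition tensor_gr (K : fieldType) (A1 A2 : stdGradedArtinian K) (m : nat) :
    {vspace tensor A1 A2} :=
  (\sum_(a < m.+1) tensv (gr A1 a) (gr A2 (m - a)))%VS.

Definition tensor_form (K : fieldType) (A1 A2 : stdGradedArtinian K)
    (al : A1) (be : A2) : tensor A1 A2 :=
  tens al 1 + tens 1 be.

(* The kernel of multiplication by l on the subspace W. For W a homogeneous
   component and l linear, the product lands in the next component (gr_mul and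
   tensor_gr_mul). *)
Definition mulker (K : fieldType) (A : falgType K) (l : A) (W : {vspace A}) :
    {vspace A} :=
  (W :&: lker (amull l))%VS.

Lemma tensor_gr_mul (K : fieldType) (A1 A2 : stdGradedArtinian K) (m : nat)
    (al : A1) (be : A2) (x : tensor A1 A2) :
  al \in gr A1 1 -> be \in gr A2 1 -> x \in tensor_gr A1 A2 m ->
  tensor_form al be * x \in tensor_gr A1 A2 m.+1.
Proof.
move=> hal hbe hx.
have sub a : (a < m.+1)%N -> forall u v, u \in gr A1 a -> v \in gr A2 (m - a) ->
    tensor_form al be * tens u v \in tensor_gr A1 A2 m.+1.
  move=> am u v hu hv; rewrite mulrDl !tensM !mul1r; apply: memvD.
    have am' : (a.+1 < m.+2)%N by [].
    apply: (subvP (sumv_sup (Ordinal am') _ (subvv _))) => //=.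
    by apply: memv_tens; [exact: (gr_mul (d := 1)) | rewrite subSS].
  have am' : (a < m.+2)%N by exact: ltnW.
  apply: (subvP (sumv_sup (Ordinal am') _ (subvv _))) => //=.
  apply: memv_tens => //; rewrite subSn //.
  exact: (gr_mul (d := 1)).
suff /subvP/(_ _ hx) : (tensor_gr A1 A2 m <=
    amull (tensor_form al be) @^-1: tensor_gr A1 A2 m.+1)%VS.
  by rewrite -memv_preim lfunE.
apply/subv_sumP => a _; apply/span_subvP => _ /allpairsP[[u v] /= [hu hv ->]].
rewrite -memv_preim lfunE /=; apply: (sub a) => //; exact: vbasis_mem.
Qed.

(* U is the complement of the common zero locus of a set S of polynomials in
   the coordinates of V (in the library basis; the notion does not depend on
   the basis). *)
Definition zariski_open (K : fieldType) (V : vectType K) (U : V -> Prop) :=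
  exists S : {mpoly K[\dim {:V}]} -> Prop,
    forall v, U v <->
      ~ (forall p, S p -> p.@[fun i => coord (vbasis {:V}) i v] = 0).

(* Main.v *)
(* In characteristic 0 the n-th powers of linear forms span the degree n part,
   so al^n and be^n are nonzero for general al and be, while al^(n+1) and
   be^(n+1) vanish. Then x = sum_i al^(n-i) (x) (-be)^i is killed by
   l = al (x) 1 - 1 (x) (-be), the product l x being a difference of (n+1)-st
   powers. Multiplication by 1 (x) (-be)^n sends x to al^n (x) (-be)^n <> 0, and
   it kills u (x) v whenever be v = 0. Hence x is nonzero, and x and u (x) v are
   linearly independent when u and v are nonzero and al u = be v = 0. *)
Require Import Defs.
From Stdlib Require Import Classical_Prop.
From mathcomp Require Import all_boot all_order all_algebra all_field.
From mathcomp Require Import mpoly.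

Set Implicit Arguments.
Unset Strict Implicit.
Unset Printing Implicit Defensive.

Import GRing.Theory.
Local Open Scope ring_scope.

(** * Polynomial functions on a vector space and Zariski open sets *)

Section PolynomialFunctions.
Variables (K : fieldType) (V : vectType K).

Definition polyfun (f : V -> K) : Prop :=
  exists p : {mpoly K[\dim {:V}]},
    forall v, f v = p.@[fun i => coord (vbasis {:V}) i v].

Lemma polyfun_const c : polyfun (fun=> c).
Proof. by exists c%:MP => v; rewrite mevalC. Qed.

Lemma polyfunD f g : polyfun f -> polyfun g -> polyfun (fun v => f v + g v).
Proof. by move=> [p hp] [q hq]; exists (p + q) => v; rewrite mevalD hp hq. Qed.

Lemma polyfunM f g : polyfun f -> polyfun g -> polyfun (fun v => f v * g v).
Proof. by move=> [p hp] [q hq]; exists (p * q) => v; rewrite mevalM hp hq. Qed.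

Lemma polyfun_ext f g : f =1 g -> polyfun f -> polyfun g.
Proof. by move=> fg [p hp]; exists p => v; rewrite -fg. Qed.

Lemma polyfun_sum (I : Type) (r : seq I) (F : I -> V -> K) :
  (forall i, polyfun (F i)) -> polyfun (fun v => \sum_(i <- r) F i v).
Proof.
move=> hF; elim: r => [|i r IH].
  by apply: polyfun_ext (polyfun_const 0) => v; rewrite big_nil.
by apply: polyfun_ext (polyfunD (hF i) IH) => v; rewrite big_cons.
Qed.

Lemma polyfun_coord_linear (W : vectType K) (f : {linear V -> W}) i :
  polyfun (fun v => coord (vbasis {:W}) i (f v)).
Proof.
exists (\sum_(j < \dim {:V}) coord (vbasis {:W}) i (f (vbasis {:V})`_j) *: 'X_j) => v.
rewrite {1}(coord_vbasis (memvf v)) !linear_sum /=.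
by apply: eq_bigr => j _; rewrite !linearZ /= mevalXU mulrC.
Qed.

Lemma polyfun_coordX (A : falgType K) (f : V -> A) n :
  (forall i, polyfun (fun v => coord (vbasis {:A}) i (f v))) ->
  forall i, polyfun (fun v => coord (vbasis {:A}) i (f v ^+ n)).
Proof.
move=> hf; elim: n => [|n IH] i.
  by apply: polyfun_ext (polyfun_const (coord (vbasis {:A}) i 1)) => v; rewrite expr0.
pose b := vbasis {:A}.
(* Bilinearity expands [f v * f v ^+ n] over the basis; the [coord b i (b]_j * b[_k)] are the
   structure constants of [A]. *)
apply: (@polyfun_ext (fun v => \sum_(j < \dim {:A}) \sum_(k < \dim {:A})
    coord b j (f v) * coord b k (f v ^+ n) * coord b i (b`_j * b`_k))).
  move=> v; rewrite exprS; set y := f v ^+ n.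
  rewrite [f v in RHS](coord_vbasis (memvf _)) [y in RHS](coord_vbasis (memvf _)) mulr_suml linear_sum.
  apply: eq_bigr => j _; rewrite mulr_sumr linear_sum.
  apply: eq_bigr => k _.
  by rewrite -scalerAl -scalerAr scalerA linearZ.
apply: polyfun_sum => j; apply: polyfun_sum => k.
by apply: polyfunM; [apply: polyfunM | exact: polyfun_const].
Qed.

(** Openness may be checked pointwise, with a separating polynomial for each point: the complement
    of [U] is then the zero locus of its whole vanishing ideal. *)
Lemma zariski_open_polyfun (U : pred V) :
  (forall v, U v -> exists f,
     [/\ polyfun f, f v != 0 & forall w, ~~ U w -> f w = 0]) ->
  zariski_open U.
Proof.
move=> hU; exists (fun p => forall w, ~~ U w ->
  p.@[fun i => coord (vbasis {:V}) i w] = 0) => v; split.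
  move=> /hU[f [[p hp] fv f0]] /(_ p) pv; move/eqP: fv; apply.
  by rewrite hp; apply: pv => w /f0; rewrite hp.
by move=> nU; apply/idPn => Uv; apply: nU => p; apply.
Qed.

End PolynomialFunctions.

Lemma coord_vbasis_neq0 (K : fieldType) (V : vectType K) (u : V) :
  u != 0 -> exists i, coord (vbasis {:V}) i u != 0.
Proof.
move=> u0; apply/existsP; apply: contraNT u0; rewrite negb_exists => /forallP h.
rewrite [u](coord_vbasis (memvf u)) big1 // => i _.
by have := h i; rewrite negbK => /eqP->; rewrite scale0r.
Qed.

(** * Polarization in characteristic 0 *)

Section Polarization.
Variable K : fieldType.
Hypothesis charK : [pchar K] =i pred0.

(** In characteristic 0 the naturals are pairwise distinct in [K], so [0, ..., size p - 1] are
    already too many roots. *)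
Lemma poly_nat_roots_eq0 (p : {poly K}) :
  (forall k : nat, p.[k%:R] = 0) -> p = 0.
Proof.
move=> hp; apply: (@roots_geq_poly_eq0 _ p [seq (k%:R : K) | k <- iota 0 (size p)]).
- by apply/allP => _ /mapP[k _ ->]; rewrite /root hp.
- rewrite map_inj_uniq ?iota_uniq // => i j ij.
  wlog le_ij : i j ij / (i <= j)%N.
    by move=> H; case/orP: (leq_total i j) => /H-> //; rewrite ij.
  apply/eqP; rewrite eqn_leq le_ij -subn_eq0 /=.
  by rewrite -((pcharf0P K).1 charK) natrB // ij subrr.
- by rewrite size_map size_iota.
Qed.

Lemma coef_eq0_of_nat_roots (V : vectType K) m (c : 'I_m -> V) :
  (forall k : nat, \sum_(i < m) k%:R ^+ i *: c i = 0) -> forall i, c i = 0.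
Proof.
move=> hc i; apply/eqP/negPn/negP => /coord_vbasis_neq0[j] /eqP; apply.
(* The coefficients of a [\poly] are indexed by [nat], so the [j]-th coordinates of [c] are extended
   by zero. *)
pose F (d : nat) := if insub d is Some d' then coord (vbasis {:V}) j (c d') else 0.
have FE (d : 'I_m) : F d = coord (vbasis {:V}) j (c d) by rewrite /F valK.
have p0 : \poly_(d < m) F d = 0.
  apply: poly_nat_roots_eq0 => k; rewrite horner_poly.
  have := congr1 (coord (vbasis {:V}) j) (hc k).
  rewrite linear0 linear_sum => E; rewrite -[RHS]E; apply: eq_bigr => d _.
  by rewrite linearZ /= FE mulrC.
by have := coef_poly m F i; rewrite p0 coef0 ltn_ord FE.
Qed.

(* The coefficient of t in (y + t x)^(m+1) w is (m+1) y^m x w. *)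
Lemma polarization_step (A : falgType K) (W : {vspace A}) (w : A) m :
    {in W &, forall x y, GRing.comm x y} ->
    {in W, forall y, y ^+ m.+1 * w = 0} ->
  {in W &, forall x y, y ^+ m * (x * w) = 0}.
Proof.
move=> cW hw x y xW yW.
(* The binomial expansion of [(y + k x) ^+ m.+1 * w] vanishes for every natural [k], hence so does
   each of its coefficients. *)
have coef0 (i : 'I_m.+2) : (y ^+ (m.+1 - i) * x ^+ i * w) *+ 'C(m.+1, i) = 0.
  move: i; apply: coef_eq0_of_nat_roots => k.
  rewrite -[RHS](hw (y + k%:R *: x)) ?memvD ?memvZ //.
  rewrite exprDn_comm ?mulr_suml; last first.
    by rewrite /GRing.comm -scalerAr -scalerAl cW.
  apply: eq_bigr => i _.
  by rewrite exprZn -scalerAr mulrnAl -scalerAl scalerMnr.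
have := coef0 (inord 1); rewrite inordK // subn1 bin1 expr1 -mulrA.
move=> /eqP; rewrite -scaler_nat scaler_eq0 ((pcharf0P K).1 charK) /=.
by move=> /eqP.
Qed.

End Polarization.

(** * Nonvanishing powers of linear forms *)

Section GradedPowers.
Variables (K : fieldType) (A : stdGradedArtinian K).

Lemma sga_mulrC (x y : A) : x * y = y * x.
Proof.
have [[p <-] [q <-]] := (sga_surj x, sga_surj y).
by rewrite -!rmorphM mulrC.
Qed.

Lemma gr_exp (x : A) d : x \in gr A 1 -> x ^+ d \in gr A d.
Proof.
move=> hx; elim: d => [|d IH]; last by rewrite exprS; apply: (gr_mul (d := 1)).
by apply/memv_gr; exists 1; [exact: dhomog1 | exact: rmorph1].
Qed.

(** If all [n]-th powers of linear forms vanished, polarization would exchange the factors [y] of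
    [y ^+ n] for variables one at a time, until every monomial of degree [n] vanished. *)
Lemma exp_gr1_neq0 (charK : [pchar K] =i pred0) n :
  gr A n <> 0%VS -> exists x : subvs_of (gr A 1), vsval x ^+ n != 0.
Proof.
move=> An.
suff [x xA xn] : exists2 x, x \in gr A 1 & x ^+ n != 0.
  by exists (Subvs xA).
apply: NNPP => none.
have pow0 y : y \in gr A 1 -> y ^+ n = 0.
  by move=> yA; apply/eqP/negPn/negP => yn; apply: none; exists y.
(* Here [d] counts the factors already exchanged: [d = 0] is [pow0], and [d = n] leaves the bare
   monomial. *)
have mon0 d (m : 'X_{1..sga_nvar A}) : mdeg m = d -> (d <= n)%N ->
    {in gr A 1, forall y, y ^+ (n - d) * sga_pres A 'X_[m] = 0}.
  elim: d m => [|d IH] m md dn y yA; first by rewrite subn0 pow0 ?mul0r.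
  have [i mi] : exists i, m i != 0%N.
    apply/existsP; apply: contra_eqT md; rewrite negb_exists => /forallP m0.
    rewrite mdegE big1 // => i _; exact/eqP/negPn/m0.
  have le_im : (U_(i) <= m)%MM by rewrite lep1mP.
  (* One variable ['X_i] is split off as the new factor; the remaining monomial, of degree [d],
     plays the role of [w]. *)
  rewrite -(submK le_im) addmC mpolyXD rmorphM.
  apply: (polarization_step charK (W := gr A 1)) => //.
  - by move=> x z _ _; apply: sga_mulrC.
  - move=> z zA; rewrite -subSn // subSS; apply: IH => //; last exact: ltnW.
    by apply/eqP; rewrite -eqSS -md -[in X in _ == X](submK le_im) mdegD mdeg1 addn1.
  - by apply/memv_gr; exists 'X_i => //; rewrite dhomogX; apply/eqP; exact: mdeg1.
apply: An; apply/eqP; rewrite -subv0; apply/span_subvP => _ /imageP[m hm ->].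
(* The factor [1] is written as [0 ^+ (n - n)], so that [mon0] applies with [d = n] and [y = 0]. *)
rewrite memv0 -[X in X == _]mul1r -(expr0 0) -{1}(subnn n).
by rewrite (mon0 n) ?mem0v //; apply/eqP.
Qed.

End GradedPowers.

(** * Kernels of multiplication and pure tensors *)

Lemma memv_mulker (K : fieldType) (A : falgType K) (l : A) (W : {vspace A}) x :
  (x \in mulker l W) = (x \in W) && (l * x == 0).
Proof. by rewrite memv_cap memv_ker lfunE. Qed.

Lemma mulker_neq0 (K : fieldType) (A : falgType K) (l : A) (W : {vspace A}) :
  mulker l W <> 0%VS -> exists u, [/\ u \in W, l * u = 0 & u != 0].
Proof.
move=> /eqP; rewrite -vpick0 => nz; exists (vpick (mulker l W)).
have := memv_pick (mulker l W).
by rewrite memv_mulker => /andP[uW /eqP lu].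
Qed.

Section TensorPowers.
Variables (K : fieldType) (A B : falgType K).
Implicit Types (a : A) (b : B).

Lemma tens0l b : tens (0 : A) b = 0.
Proof. by rewrite -(scale0r 0) tensZl scale0r. Qed.

Lemma tens0r a : tens a (0 : B) = 0.
Proof. by rewrite -(scale0r 0) tensZr scale0r. Qed.

Lemma tensX a b n : tens a b ^+ n = tens (a ^+ n) (b ^+ n).
Proof. by elim: n => [//|n IH]; rewrite !exprS IH tensM. Qed.

End TensorPowers.

Lemma memv_tensor_gr (K : fieldType) (A1 A2 : stdGradedArtinian K) i j m u v :
  (i + j)%N = m -> u \in gr A1 i -> v \in gr A2 j ->
  tens u v \in tensor_gr A1 A2 m.
Proof.
move=> <- hu hv.
have im : (i < (i + j).+1)%N by rewrite ltnS leq_addr.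
apply: (subvP (sumv_sup (Ordinal im) _ (subvv _))) => //=.
by apply: memv_tens; rewrite // addKn.
Qed.

(** * The kernel element built from powers of [al] and [be] *)

Section PowerSum.
Variables (K : fieldType) (A1 A2 : stdGradedArtinian K) (n : nat).
Hypotheses (n_gt0 : (0 < n)%N).
Hypotheses (A1Sn : gr A1 n.+1 = 0%VS) (A2Sn : gr A2 n.+1 = 0%VS).
Variables (al : A1) (be : A2).
Hypotheses (al1 : al \in gr A1 1) (be1 : be \in gr A2 1).
Hypotheses (aln : al ^+ n != 0) (ben : be ^+ n != 0).

Let a : tensor A1 A2 := tens al 1.
Let b : tensor A1 A2 := tens 1 (- be).

Definition power_sum : tensor A1 A2 :=
  \sum_(i < n.+1) a ^+ (n - i) * b ^+ i.

Let formE : tensor_form al be = a - b.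
Proof. by rewrite /tensor_form /a /b -[- be]scaleN1r tensZr scaleN1r opprK. Qed.

Let comm_ab : GRing.comm a b.
Proof. by rewrite /GRing.comm !tensM !mul1r !mulr1. Qed.

Let aSn : a ^+ n.+1 = 0.
Proof.
rewrite tensX expr1n; have := gr_exp n.+1 al1.
by rewrite A1Sn memv0 => /eqP->; rewrite tens0l.
Qed.

Let bSn : b ^+ n.+1 = 0.
Proof.
have be1N : - be \in gr A2 1 by rewrite rpredN.
rewrite tensX expr1n; have := gr_exp n.+1 be1N.
by rewrite A2Sn memv0 => /eqP->; rewrite tens0r.
Qed.

Lemma power_sum_gr : power_sum \in tensor_gr A1 A2 n.
Proof.
apply: memv_suml => i _; rewrite !tensX !expr1n tensM mulr1 mul1r.
apply: (memv_tensor_gr (i := n - i) (j := i)); first by rewrite subnK // -ltnS.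
  exact: gr_exp.
by apply: gr_exp; rewrite rpredN.
Qed.

Lemma power_sum_mulker :
  power_sum \in mulker (tensor_form al be) (tensor_gr A1 A2 n).
Proof.
rewrite memv_mulker power_sum_gr formE -(subrXX_comm n.+1 comm_ab).
by rewrite aSn bSn subrr eqxx.
Qed.

Lemma power_sum_mulX : power_sum * b ^+ n != 0.
Proof.
(* Only the term [a ^+ n] survives: every other one acquires a factor [b ^+ n.+1], which is zero. *)
rewrite mulr_suml big_ord_recl subn0 mulr1 big1 ?addr0 => [|i _]; last first.
  by rewrite -mulrA -exprD lift0 addSnnS addnC exprD bSn mul0r mulr0.
rewrite !tensX !expr1n tensM mulr1 mul1r exprNn -signr_odd.
apply/eqP => /tens_eq0[] /eqP; first exact/negP.
by rewrite mulr_sign; case: ifP; rewrite ?oppr_eq0 (negPf ben).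
Qed.

Lemma power_sum_neq0 : power_sum != 0.
Proof. by apply: contraNneq power_sum_mulX => ->; rewrite mul0r. Qed.

Lemma dim_mulker_ge2 i j u v :
    (i + j)%N = n -> u \in gr A1 i -> v \in gr A2 j ->
    al * u = 0 -> be * v = 0 -> u != 0 -> v != 0 ->
  (2 <= \dim (mulker (tensor_form al be) (tensor_gr A1 A2 n)))%N.
Proof.
move=> ijn hu hv alu bev u0 v0.
have uv_mulker :
    tens u v \in mulker (tensor_form al be) (tensor_gr A1 A2 n).
  rewrite memv_mulker (memv_tensor_gr ijn) // mulrDl !tensM alu bev.
  by rewrite tens0l tens0r addr0 eqxx.
have uv0 : tens u v != 0.
  by apply/eqP => /tens_eq0[] /eqP; exact/negP.
have uvb : tens u v * b ^+ n = 0.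
  (* Since [n] is positive, a factor [be] can be taken out of [(- be) ^+ n] to kill [v]. *)
  rewrite tensX expr1n tensM mulr1 -(prednK n_gt0) exprS mulrA mulrN.
  by rewrite sga_mulrC [v * be]sga_mulrC bev oppr0 mulr0 tens0r.
have uv_free : free [:: tens u v; power_sum].
  rewrite free_cons seq1_free power_sum_neq0 andbT span_seq1.
  (* Multiplying [tens u v = k *: power_sum] by [b ^+ n] kills the left side but not [power_sum],
     which forces [k = 0]. *)
  apply/negP => /vlineP[k uvE]; have /eqP := uvb.
  rewrite uvE -scalerAl scaler_eq0 (negPf power_sum_mulX) orbF => /eqP k0.
  by move: uv0; rewrite uvE k0 scale0r eqxx.
have := eqnP uv_free; rewrite /= => <-; apply/dimvS/span_subvP => x.
by rewrite !inE => /orP[] /eqP->; [exact: uv_mulker | exact: power_sum_mulker].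
Qed.

End PowerSum.

(** * The open set of general linear forms and the conclusion *)

Lemma zariski_open_exp_neq0 (K : fieldType) (V : vectType K)
    (A B : falgType K) (f : {linear V -> A}) (g : {linear V -> B}) n :
  zariski_open (fun v => (f v ^+ n != 0) && (g v ^+ n != 0)).
Proof.
apply: zariski_open_polyfun => v.
move=> /andP[/coord_vbasis_neq0[i fi] /coord_vbasis_neq0[j gj]].
(* One nonzero coordinate of each power at [v] is chosen; their product vanishes as soon as either
   power does. *)
exists (fun w => coord (vbasis {:A}) i (f w ^+ n) *
                 coord (vbasis {:B}) j (g w ^+ n)); split.
- by apply: polyfunM; apply: polyfun_coordX => k; exact: polyfun_coord_linear.
- by rewrite mulf_neq0.
- by move=> w; rewrite negb_and !negbK => /orP[] /eqP->;
    rewrite linear0 ?mul0r ?mulr0.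
Qed.

Theorem proposition4p4 (K : fieldType) (charK : [pchar K] =i pred0)
    (A1 A2 : stdGradedArtinian K) (n : nat) (n_gt0 : (0 < n)%N)
    (A1n : gr A1 n <> 0%VS) (A2n : gr A2 n <> 0%VS)
    (A1Sn : gr A1 n.+1 = 0%VS) (A2Sn : gr A2 n.+1 = 0%VS) :
  exists U : (subvs_of (gr A1 1) * subvs_of (gr A2 1))%type -> Prop,
    [/\ zariski_open U,
        exists v, U v
      & forall (al : subvs_of (gr A1 1)) (be : subvs_of (gr A2 1)),
          U (al, be) ->
          let l := tensor_form (vsval al) (vsval be) in
          mulker l (tensor_gr A1 A2 n) <> 0%VS /\
          ((exists i j : nat,
              [/\ (i + j)%N = n,
                  mulker (vsval al) (gr A1 i) <> 0%VS
                & mulker (vsval be) (gr A2 j) <> 0%VS]) ->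
           (2 <= \dim (mulker l (tensor_gr A1 A2 n)))%N)].
Proof.
(* Generality of the linear form enters only through the nonvanishing of these two powers. *)
exists (fun v => (vsval v.1 ^+ n != 0) && (vsval v.2 ^+ n != 0)); split.
- exact: (zariski_open_exp_neq0 (vsval \o fst) (vsval \o snd)).
- have [[al aln] [be ben]] := (exp_gr1_neq0 charK A1n, exp_gr1_neq0 charK A2n).
  by exists (al, be); rewrite aln ben.
move=> al be /= /andP[aln ben].
have [al1 be1] := (subvsP al, subvsP be); split.
  move=> ker0; have := power_sum_mulker A1Sn A2Sn al1 be1.
  by rewrite ker0 memv0; apply/negP; exact: power_sum_neq0.
move=> [i [j [ijn /mulker_neq0[u [hu alu u0]] /mulker_neq0[v [hv bev v0]]]]].
exact: (dim_mulker_ge2 n_gt0 A1Sn A2Sn al1 be1 aln ben ijn hu hv).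
Qed.
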